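(* $A_3(n)=O(n)$.
   Context: There are $n$ balls, each colored red or blue in an unknown way. A ball $b$ is a non-minority ball of the set of all $n$ balls if at least $n/2$ balls have the color of $b$. A query is a set of three balls; the answer is (the index of) a majority ball of the triple, i.e. a ball whose color is shared by another ball of the triple (chosen adversarially if there are several). $A_3(n)$ is the minimum, over adaptive strategies (each query may depend on the answers to earlier queries), of the worst-case number of queries needed to name a ball that is guaranteed to be a non-minority ball of the whole set, i.e. non-minority in every coloring consistent with the answers. *)

(* Defs.v *)
From mathcomp Require Import all_boot.

Set Implicit Arguments.
Unset Strict Implicit.
Unset Printing Implicit Defensive.

Definition coloring (n : nat) := {ffun 'I_n -> bool}.

Definition triple (n : nat) := {Q : {set 'I_n} | #|Q| == 3}.

Definition majority_ball n (c : coloring n) (Q : triple n) (a : 'I_n) : bool :=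
  (a \in val Q) && [exists b in val Q, (b != a) && (c b == c a)].

Definition non_minority n (c : coloring n) (b : 'I_n) : bool :=
  n <= 2 * #|[set x | c x == c b]|.

(* Adaptive strategies are finite decision trees: [Ask Q next] queries [Q] and
   continues with [next a] on answer [a]; branches [next a] for an [a] that is
   not a possible answer are never followed by a [play]. *)
Inductive strategy (n : nat) : Type :=
| Name of 'I_n
| Ask of triple n & ('I_n -> strategy n).

Definition transcript (n : nat) := seq (triple n * 'I_n).

Definition consistent n (c : coloring n) (h : transcript n) : bool :=
  all (fun qa => majority_ball c qa.1 qa.2) h.

Inductive run (n : nat) : strategy n -> transcript n -> 'I_n -> Prop :=
| RunName b : run (Name b) [::] b
| RunAsk Q next a h b : run (next a) h b -> run (Ask Q next) ((Q, a) :: h) b.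

Definition play n (s : strategy n) (h : transcript n) (b : 'I_n) : Prop :=
  run s h b /\ exists c : coloring n, consistent c h.

Definition successful n (s : strategy n) : Prop :=
  forall h b, play s h b ->
  forall c : coloring n, consistent c h -> non_minority c b.

Definition worst_case n (s : strategy n) (k : nat) : Prop :=
  (exists h b, play s h b /\ size h = k) /\
  (forall h b, play s h b -> size h <= k).

(* [is_A3 n k] reads "A_3(n) exists and equals k"; A_3 is a relation because
   the existence of a successful strategy is not immediate (and fails for
   n = 0, where there is no ball to name). *)
Definition is_A3 (n k : nat) : Prop :=
  (exists s : strategy n, successful s /\ worst_case s k) /\
  (forall (s : strategy n) k', successful s -> worst_case s k' -> k <= k').

(* Main.v *)
(** Fix a ball x. A query {x, u, v} answered by u says that if u differs from x then so
    does v; answered by x it says that u and v do not both differ from x. A majority vote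
    with a counter, driven by these answers, finds a ball b such that x is a non-minority
    ball unless b and x differ. Under the assumption that they do differ, the queries
    {x, u, v} and {b, u, v} either order u and v (in the order "colour of x before colour
    of b") or show that they are opposite. Comparing all remaining balls with an opposite
    pair either reveals the colours of everything compared so far, the pair included, or
    leaves a single unknown bit, so a comparison has amortized constant cost. The linear
    median algorithm then gives a ball w that is a non-minority ball if x and b differ,
    and the answer to the query {x, b, w} is a non-minority ball in all cases. *)

Require Import Defs.
From Stdlib Require Import Classical.
From mathcomp Require Import all_boot zify.

Set Implicit Arguments.
Unset Strict Implicit.
Unset Printing Implicit Defensive.

(** * Selection with linearly many comparisons *)

Section Selection.
Variable T : Type.
Implicit Types (P : (T -> bool) -> Prop) (X : eqType).

Definition refines (D : Type) (P' P : D -> Prop) := forall f, P' f -> P f.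

Definition implied_le P (u v : T) := forall f, P f -> f u -> f v.

(* A state of knowledge is the set [P] of the 0/1 valuations still possible, and
   comparing [u] with [v] yields one of the two implications between their values. *)
Inductive cmp_solvable (Goal : ((T -> bool) -> Prop) -> Prop) :
    ((T -> bool) -> Prop) -> nat -> Prop :=
| CmpDone P d : Goal P -> cmp_solvable Goal P d
| CmpAsk u v P d :
    cmp_solvable Goal (fun f => P f /\ (f u -> f v)) d ->
    cmp_solvable Goal (fun f => P f /\ (f v -> f u)) d ->
    cmp_solvable Goal P d.+1.

Variable Goal : ((T -> bool) -> Prop) -> Prop.

Lemma cmp_solvable_leq P d d' :
  d <= d' -> cmp_solvable Goal P d -> cmp_solvable Goal P d'.
Proof.
move=> le_dd' sol; elim: sol d' le_dd' => {P d} [P d GP d' _|u v P d _ IH1 _ IH2 [//|d'] le_dd'].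
  exact: CmpDone.
by apply: CmpAsk; [exact: IH1|exact: IH2].
Qed.

Lemma implied_le_refines P P' u v :
  refines P' P -> implied_le P u v -> implied_le P' u v.
Proof. by move=> sub le f /sub; apply: le. Qed.

Lemma implied_le_trans P v u w :
  implied_le P u v -> implied_le P v w -> implied_le P u w.
Proof. by move=> le1 le2 f Pf /(le1 f Pf); apply: le2. Qed.

(* Items carry a key so that the recursive call can select among groups,
   compared through their medians. *)
Definition split_at X (key : X -> T) P (s A : seq X) (w : X) (B : seq X) :=
  [/\ perm_eq s (A ++ w :: B),
      {in A, forall a, implied_le P (key a) (key w)} &
      {in B, forall a, implied_le P (key w) (key a)}].

(** Continuation-passing form: comparisons only shrink the set of valuations, so the task left after
    the selection, of cost [k], must be solvable from every refinement [P'] that certifies an item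
    of rank [j]. *)
Definition selectable X (key : X -> T) (s : seq X) (j t : nat) :=
  forall P k,
  (forall P' A w B, refines P' P -> size A = j -> split_at key P' s A w B ->
     cmp_solvable Goal P' k) ->
  cmp_solvable Goal P (k + t).

Lemma partition_by X (key : X -> T) p (r : seq X) P k :
  (forall P' L G, refines P' P -> perm_eq r (L ++ G) ->
     {in L, forall a, implied_le P' (key a) (key p)} ->
     {in G, forall a, implied_le P' (key p) (key a)} ->
     cmp_solvable Goal P' k) ->
  cmp_solvable Goal P (k + size r).
Proof.
elim: r P => [|z r IH] P cont /=.
  by rewrite addn0; apply: (cont P [::] [::]).
rewrite addnS; apply: (CmpAsk (u := key z) (v := key p)).
  apply: IH => P' L G sub prm leL leG; apply: (cont P' (z :: L) G) => //.
  - by move=> f /sub [].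
  - by rewrite /= perm_cons.
  - by move=> a; rewrite inE => /orP[/eqP-> f /sub []|/leL].
apply: IH => P' L G sub prm leL leG; apply: (cont P' L (z :: G)) => //.
- by move=> f /sub [].
- by rewrite perm_sym (perm_catCA L [:: z] G) /= perm_cons perm_sym.
- by move=> a; rewrite inE => /orP[/eqP-> f /sub []|/leG].
Qed.

Lemma selectable_leq X (key : X -> T) s j t t' :
  t <= t' -> selectable key s j t -> selectable key s j t'.
Proof.
move=> le_tt' sel P k /sel; apply: cmp_solvable_leq; lia.
Qed.

(** Quickselect step: the pivot [p] has rank [size L], so the item of rank [j] is [p] or lies on one
    side, with its rank lowered by [size L + 1] on the upper one. *)
Lemma select_side X (key : X -> T) (s L : seq X) p (G : seq X) j t P k :
  split_at key P s L p G ->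
  (j < size L -> selectable key L j t) ->
  (size L < j -> selectable key G (j - (size L).+1) t) ->
  (forall P' A w B, refines P' P -> size A = j -> split_at key P' s A w B ->
     cmp_solvable Goal P' k) ->
  cmp_solvable Goal P (k + t).
Proof.
move=> [prm leL leG] selL selG cont.
case: (ltngtP j (size L)) => [ltj|gtj|eqj].
- apply: (selL ltj) => P' A w B sub szA [prmL leA leB].
  have wL : w \in L by rewrite (perm_mem prmL) mem_cat mem_head orbT.
  have lewp := implied_le_refines sub (leL _ wL).
  apply: (cont P' A w (B ++ p :: G)) => //; split=> //.
    by rewrite (perm_trans prm) // -cat_cons catA perm_cat.
  move=> a; rewrite mem_cat inE => /or3P[/leB //|/eqP -> //|/leG le_pa].
  exact: implied_le_trans lewp (implied_le_refines sub le_pa).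
- apply: (selG gtj) => P' A w B sub szA [prmG leA leB].
  have wG : w \in G by rewrite (perm_mem prmG) mem_cat mem_head orbT.
  have lepw := implied_le_refines sub (leG _ wG).
  apply: (cont P' (L ++ p :: A) w B) => //.
    by rewrite size_cat /= szA; lia.
  split=> //.
    by rewrite (perm_trans prm) // -catA /= perm_cat2l perm_cons.
  move=> a; rewrite mem_cat inE => /or3P[/leL le_ap|/eqP -> //|/leA //].
  exact: implied_le_trans (implied_le_refines sub le_ap) lepw.
- apply: cmp_solvable_leq (cont P L p G _ _ _) => //; lia.
Qed.

Lemma selectable_quadratic X (key : X -> T) m (s : seq X) j :
  size s <= m -> j < size s -> selectable key s j (m * m).
Proof.
elim: m s j => [|m IH] [|p r] j //= le_sm lt_js P k cont.
have -> : k + m.+1 * m.+1 = k + m * m + m + m + 1 by lia.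
apply: (@cmp_solvable_leq _ (k + m * m + size r)); first lia.
apply: (partition_by (key := key) (p := p)) => P' L G sub prm leL leG.
have szLG : size r = size L + size G by rewrite (perm_size prm) size_cat.
have sp : split_at key P' (p :: r) L p G.
  by split=> //; rewrite perm_sym (perm_catCA L [:: p] G) /= perm_cons perm_sym.
apply: (select_side (j := j) sp) => [ltj|gtj|P2 A w B sub2].
- apply: IH => //; lia.
- apply: IH; lia.
- by apply: cont => f /sub2 /sub.
Qed.

(** A group is encoded as a triple (median, lower items, upper items). *)
Definition ungroup X (g : X * seq X * seq X) := g.1.2 ++ g.1.1 :: g.2.

Definition group_of_five X (key : X -> T) P (g : X * seq X * seq X) :=
  [/\ size g.1.2 = 2, size g.2 = 2,
      {in g.1.2, forall a, implied_le P (key a) (key g.1.1)} &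
      {in g.2, forall a, implied_le P (key g.1.1) (key a)}].

Lemma group_of_five_refines X (key : X -> T) P P' g :
  refines P' P -> group_of_five key P g -> group_of_five key P' g.
Proof.
move=> sub [s1 s2 le1 le2]; split=> // a.
  by move=> /le1; apply: implied_le_refines.
by move=> /le2; apply: implied_le_refines.
Qed.

Lemma make_groups X (key : X -> T) q (s : seq X) P k :
  5 * q <= size s ->
  (forall P' gs r, refines P' P -> size gs = q ->
     perm_eq s (flatten (map (@ungroup X) gs) ++ r) ->
     {in gs, forall g, group_of_five key P' g} ->
     cmp_solvable Goal P' k) ->
  cmp_solvable Goal P (k + 25 * q).
Proof.
elim: q s P => [|q IH] s P le_qs cont.
  by rewrite muln0 addn0; apply: (cont P [::] s).
have sz5 : size (take 5 s) = 5 by rewrite size_take; case: ltnP; lia.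
have -> : k + 25 * q.+1 = k + 25 * q + 5 * 5 by lia.
(* Rank 2 among five items is their median, found with [5 * 5] comparisons. *)
apply: (@selectable_quadratic _ key 5 (take 5 s) 2); rewrite ?sz5 //.
move=> P1 A w B sub1 szA [prm leA leB].
have szB : size B = 2.
  by have := perm_size prm; rewrite size_cat /= sz5 szA => -[].
apply: (IH (drop 5 s)) => [|P2 gs r sub2 szgs prm2 grp]; first by rewrite size_drop; lia.
have grp1 : group_of_five key P1 (w, A, B) by [].
apply: (cont P2 ((w, A, B) :: gs) r) => [f /sub2 /sub1 //||| g].
- by rewrite /= szgs.
- by rewrite -[s in perm_eq s](cat_take_drop 5) /= -catA perm_cat.
- rewrite inE => /orP[/eqP ->|/grp //].
  exact: group_of_five_refines grp1.
Qed.

Lemma perm_groups_low X (gs : seq (X * seq X * seq X)) :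
  perm_eq (flatten (map (@ungroup X) gs))
    (flatten [seq g.1.1 :: g.1.2 | g <- gs] ++ flatten [seq g.2 | g <- gs]).
Proof.
elim: gs => //= g gs IH; apply/permP => a; have /permP /(_ a) := IH.
rewrite /ungroup /= !count_cat /= ?count_cat => ->; lia.
Qed.

Lemma perm_groups_high X (gs : seq (X * seq X * seq X)) :
  perm_eq (flatten (map (@ungroup X) gs))
    (flatten [seq g.1.2 | g <- gs] ++ flatten [seq g.1.1 :: g.2 | g <- gs]).
Proof.
elim: gs => //= g gs IH; apply/permP => a; have /permP /(_ a) := IH.
rewrite /ungroup /= !count_cat /= ?count_cat => ->; lia.
Qed.

Lemma size_flatten_const (U : Type) (V : eqType) (F : V -> seq U) n (l : seq V) :
  {in l, forall g, size (F g) = n} -> size (flatten (map F l)) = n * size l.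
Proof.
elim: l => [|g l IH] sz /=; first by rewrite muln0.
rewrite size_cat sz ?mem_head // IH ?mulnS // => h hl; apply: sz.
by rewrite inE hl orbT.
Qed.

(* The median-of-medians recursion: groups of five, the median of their medians
   as pivot, and one recursive call on at most m - 3q/2 items, q = m %/ 5. *)
Lemma selectable_linear X (key : X -> T) (s : seq X) j :
  j < size s -> selectable key s j (68 * size s).
Proof.
have [m] := ubnP (size s); elim: m X key s j => // m IH X key s j lt_sm lt_js.
have [lt5|ge5] := ltnP (size s) 5.
  apply: selectable_leq (@selectable_quadratic _ key (size s) _ _ _ lt_js) => //; nia.
pose q := size s %/ 5.
have q_gt0 : 0 < q by rewrite divn_gt0.
have szs5 : 5 * q <= size s by rewrite mulnC leq_divM.
have szs5' : size s < 5 * q + 5 by rewrite /q; lia.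
move: q q_gt0 szs5 szs5' => q q_gt0 szs5 szs5' P k cont.
(* Either side of the pivot will have at least 3q/2 items fewer than [s]. This saves 68 * 3q/2 =
   102q, which covers 68q + 25q for the median of medians and the groups, and [size s] <= 5q + 4 <=
   9q for the partition. *)
pose t := 68 * (size s - q - q./2 - odd q).
apply: (@cmp_solvable_leq _ (k + t + size s + 68 * q + 25 * q)); first by rewrite /t; lia.
apply: (make_groups (key := key) szs5) => P1 gs r sub1 szgs prm grp.
rewrite -szgs; apply: (IH _ (fun g : X * seq X * seq X => key g.1.1) gs q./2); rewrite ?szgs; [lia | lia | ].
move=> P2 A [[p pl] ph] B sub2 szA [prm2 leA leB]; rewrite /= in leA leB.
have {}grp : {in gs, forall g, group_of_five key P2 g}.
  by move=> g /grp; apply: group_of_five_refines.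
have [szpl szph lepl leph] : group_of_five key P2 (p, pl, ph).
  by apply: grp; rewrite (perm_mem prm2) mem_cat mem_head orbT.
have grpA : {in A, forall g, group_of_five key P2 g}.
  by move=> g gA; apply: grp; rewrite (perm_mem prm2) mem_cat gA.
have grpB : {in B, forall g, group_of_five key P2 g}.
  by move=> g gB; apply: grp; rewrite (perm_mem prm2) mem_cat inE gB !orbT.
(* By transitivity through the medians, [L0] lies below [p] and [G0] above it; only [r0] remains to
   be compared with [p]. *)
pose L0 := flatten [seq g.1.1 :: g.1.2 | g <- A] ++ pl.
pose G0 := flatten [seq g.1.1 :: g.2 | g <- B] ++ ph.
pose r0 := flatten [seq g.2 | g <- A] ++ flatten [seq g.1.2 | g <- B] ++ r.
have szL0 : size L0 = 3 * q./2 + 2.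
  rewrite size_cat szpl (@size_flatten_const _ _ _ 3) ?szA // => g /grpA [/= -> //].
have szB : size A + size B = q.-1.
  by have := perm_size prm2; rewrite size_cat /= szgs; lia.
have szG0 : size G0 = 3 * (q.-1 - q./2) + 2.
  rewrite size_cat szph (@size_flatten_const _ _ _ 3); first by rewrite -szB szA; lia.
  by move=> g /grpB [/= _ -> ].
have leL0 : {in L0, forall a, implied_le P2 (key a) (key p)}.
  move=> a; rewrite mem_cat => /orP[/flatten_mapP[g gA]|/lepl //].
  rewrite inE => /orP[/eqP ->|agl]; first exact: leA.
  by have [_ _ /(_ a agl) le1 _] := grpA _ gA; apply: implied_le_trans le1 (leA _ gA).
have leG0 : {in G0, forall a, implied_le P2 (key p) (key a)}.
  move=> a; rewrite mem_cat => /orP[/flatten_mapP[g gB]|/leph //].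
  rewrite inE => /orP[/eqP ->|agl]; first exact: leB.
  by have [_ _ _ /(_ a agl) le1] := grpB _ gB; apply: implied_le_trans (leB _ gB) le1.
have prm0 : perm_eq s (L0 ++ p :: G0 ++ r0).
  rewrite (perm_trans prm) //.
  have /permP prmf := perm_flatten (perm_map (@ungroup X) prm2).
  apply/permP => a; have /permP /(_ a) pA := perm_groups_low A.
  have /permP /(_ a) pB := perm_groups_high B.
  rewrite !count_cat in pA pB.
  rewrite !count_cat /= !count_cat prmf map_cat flatten_cat count_cat pA /=.
  rewrite count_cat pB /ungroup /= count_cat /=; lia.
have szr : size s = size L0 + size G0 + size r0 + 1.
  by rewrite (perm_size prm0) size_cat /= size_cat; lia.
move: L0 G0 r0 szL0 szG0 leL0 leG0 prm0 szr => L0 G0 r0 szL0 szG0 leL0 leG0 prm0 szr.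
apply: (@cmp_solvable_leq _ (k + t + size r0)); first lia.
apply: (partition_by (key := key) (p := p)) => P3 L G sub3 prmr leL leG.
have szLG : size r0 = size L + size G by rewrite (perm_size prmr) size_cat.
have sp : split_at key P3 s (L0 ++ L) p (G0 ++ G).
  split.
  - rewrite (perm_trans prm0) //; apply/permP => a; have /permP /(_ a) := prmr.
    by rewrite !count_cat /= !count_cat => ->; lia.
  - move=> a; rewrite mem_cat => /orP[/leL0|/leL //].
    exact: implied_le_refines.
  - move=> a; rewrite mem_cat => /orP[/leG0|/leG //].
    exact: implied_le_refines.
apply: (select_side (j := j) sp) => [ltj|gtj|P4 A' w B' sub4].
- apply: selectable_leq (IH _ key (L0 ++ L) j _ ltj); rewrite size_cat; rewrite /t; lia.
- have ltj : j - (size (L0 ++ L)).+1 < size (G0 ++ G).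
    by move: gtj; rewrite !size_cat; lia.
  apply: selectable_leq (IH _ key _ _ _ ltj); rewrite size_cat; rewrite /t; lia.
- by apply: cont => f /sub4 /sub3 /sub2 /sub1.
Qed.

End Selection.

(** * Queries as knowledge refinement *)

Section Game.
Variable n : nat.
Implicit Types (S : coloring n -> Prop) (c : coloring n) (b u v w x z : 'I_n).

(** [S] is the set of colorings still possible. The bound [k] covers all runs, even those that no
    coloring realizes. *)
Definition winnable S k :=
  exists s : strategy n, forall h b, run s h b ->
    size h <= k /\ forall c, S c -> consistent c h -> non_minority c b.

Lemma winnable_leq S k k' : k <= k' -> winnable S k -> winnable S k'.
Proof.
move=> le_kk' [s win]; exists s => h b /win[le_hk]; split=> //.
exact: leq_trans le_kk'.
Qed.

Lemma winnable_name S b k : (forall c, S c -> non_minority c b) -> winnable S k.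
Proof.
move=> nm; exists (Name b) => h b' run_h; inversion run_h; subst.
by split=> // c /nm.
Qed.

Lemma winnable_ask (Q : triple n) S k :
  (forall a, winnable (fun c => S c /\ majority_ball c Q a) k) ->
  winnable S k.+1.
Proof.
move=> /fin_all_exists[next win]; exists (Ask Q next) => h b run_h.
inversion run_h as [|Q' next' a h' b' run_h']; subst.
have [le_hk nm] := win _ _ _ run_h'; split=> // c Sc /= /andP[maj cons].
exact: nm.
Qed.

Lemma card_triple x u v : x != u -> x != v -> u != v -> #|[set x; u; v]| == 3.
Proof.
by move=> xu xv uv; rewrite -setUA cardsU1 cards2 !inE negb_or xu xv uv.
Qed.

Lemma winnable_ask3 x u v S k :
  x != u -> x != v -> u != v ->
  winnable (fun c => S c /\ (c x = c u \/ c x = c v)) k ->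
  winnable (fun c => S c /\ (c u = c x \/ c u = c v)) k ->
  winnable (fun c => S c /\ (c v = c x \/ c v = c u)) k ->
  winnable S k.+1.
Proof.
move=> xu xv uv wx wu wv.
pose Q : triple n := exist _ [set x; u; v] (card_triple xu xv uv).
have weaken S1 S2 : refines S1 S2 -> winnable S2 k -> winnable S1 k.
  move=> sub [s win]; exists s => h b /win[le_hk nm]; split=> // c /sub.
  exact: nm.
apply: (winnable_ask (Q := Q)) => a; have [aQ|aQ] := boolP (a \in val Q); last first.
  (* An answer outside the triple is consistent with no coloring, so any name will do. *)
  by apply: (winnable_name (b := a)) => c [_ /andP[]]; rewrite (negbTE aQ).
move: aQ; rewrite !inE -orbA => /or3P[] /eqP->.
- apply: weaken wx => c [Sc /andP[_ /exists_inP[d dQ maj]]]; split=> //.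
  by move: dQ maj; rewrite !inE -orbA => /or3P[] /eqP->; rewrite ?eqxx // => /andP[_ /eqP]; auto.
- apply: weaken wu => c [Sc /andP[_ /exists_inP[d dQ maj]]]; split=> //.
  by move: dQ maj; rewrite !inE -orbA => /or3P[] /eqP->; rewrite ?eqxx // => /andP[_ /eqP]; auto.
- apply: weaken wv => c [Sc /andP[_ /exists_inP[d dQ maj]]]; split=> //.
  by move: dQ maj; rewrite !inE -orbA => /or3P[] /eqP->; rewrite ?eqxx // => /andP[_ /eqP]; auto.
Qed.

(** * Majority vote against a fixed ball *)

Lemma non_minority_eq c u v : c u = c v -> non_minority c u = non_minority c v.
Proof. by rewrite /non_minority => ->. Qed.

Lemma non_minority_or c u v : c u != c v -> non_minority c u || non_minority c v.
Proof.
move=> uv; rewrite /non_minority.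
have -> : [set z | c z == c v] = ~: [set z | c z == c u].
  by apply/setP => z; rewrite !inE; case: (c z) (c u) (c v) uv => [] [] [].
have := cardsC [set z | c z == c u]; rewrite card_ord; lia.
Qed.

(* A majority vote between balls coloured like [x] and the others. The counter [k]
   bounds the surplus of the latter: by [k] if [b] differs from [x], by [- k] if not. *)
Lemma find_challenger x l b p k S m :
  uniq (x :: l ++ p) -> b \in p ->
  (forall c, S c -> if c b == c x
     then count (fun z => c z != c x) p + k <= count (fun z => c z == c x) p
     else count (fun z => c z != c x) p <= count (fun z => c z == c x) p + k) ->
  (forall S' b', refines S' S -> b' != x ->
     (forall c, S' c -> c b' = c x ->
        count (fun z => c z != c x) (l ++ p) <= count (fun z => c z == c x) (l ++ p)) ->
     winnable S' m) ->
  winnable S (m + size l).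
Proof.
elim: l b p k S => [|z l IH] b p k S Ul bp inv cont /=.
  have bx : b != x.
    by apply: contraTneq Ul => <-; rewrite /= bp.
  rewrite addn0; apply: (cont S b) => // c /inv.
  move=> inv_c /eqP bcx; move: inv_c; rewrite bcx /=; lia.
have [xz xp zl zp] : [/\ x != z, x \notin p, z \notin l & z \notin p].
  by move: Ul; rewrite /= !inE !mem_cat !negb_or => /and3P[/and3P[-> _ ->] /andP[-> ->]].
have xb : x != b by apply: contraNneq xp => ->.
have bz : b != z by apply: contraNneq zp => <-.
have Ul' : uniq (x :: l ++ z :: p).
  rewrite (perm_uniq (s2 := x :: (z :: l) ++ p)) //.
  by apply/permP => a; rewrite /= !count_cat /=; clear; lia.
have cnt (a : pred 'I_n) : count a (l ++ z :: p) = count a ((z :: l) ++ p).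
  by rewrite !count_cat /=; clear; lia.
have cont' S' : refines S' S -> forall S2 b', refines S2 S' -> b' != x ->
    (forall c, S2 c -> c b' = c x ->
      count (fun z => c z != c x) (l ++ z :: p) <= count (fun z => c z == c x) (l ++ z :: p)) ->
    winnable S2 m.
  move=> sub S2 b' sub2 b'x inv2; apply: (cont S2 b') => // [c /sub2 /sub //|c Sc bc].
  by rewrite -!cnt; apply: inv2.
have sub1 Q : refines (fun c => S c /\ Q c) S by move=> c [].
case: k inv => [|k] inv.
  (* At counter 0 the invariant no longer depends on [b], so [z] becomes the candidate with counter
     1, without a query. *)
  apply: (@winnable_leq _ (m + size l)); first by rewrite leq_add2l.
  apply: (IH z (z :: p) 1) (cont' _ _) => //; first exact: mem_head.
  move=> c /inv /=; case: (c b == c x); case: (c z == c x) => /=; clear; lia.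
(* Answer [x]: not both of [b], [z] differ from [x], and the counter drops. Otherwise, of [b] and
   [z], the ball not answered becomes the candidate and the counter rises: if it agrees with [x], so
   does the other. *)
rewrite addnS; apply: (@winnable_ask3 x b z) => //.
- apply: (IH b (z :: p) k) (cont' _ (sub1 _)) => //; first by rewrite inE bp orbT.
  move=> c /= [/inv inv_c maj]; move: inv_c.
  case: (c x) (c b) (c z) maj => [] [] [] /= [] //=; clear; lia.
- apply: (IH z (z :: p) k.+2) (cont' _ (sub1 _)) => //; first exact: mem_head.
  move=> c /= [/inv inv_c maj]; move: inv_c.
  case: (c x) (c b) (c z) maj => [] [] [] /= [] //=; clear; lia.
- apply: (IH b (z :: p) k.+2) (cont' _ (sub1 _)) => //; first by rewrite inE bp orbT.
  move=> c /= [/inv inv_c maj]; move: inv_c.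
  case: (c x) (c b) (c z) maj => [] [] [] /= [] //=; clear; lia.
Qed.

(** * Comparisons relative to two reference balls *)

Section References.
Variables x b : 'I_n.
Hypothesis neq_xb : x != b.

(** When [x] and [b] have different colors, this is the 0/1 valuation on which the selection runs,
    with [x] at 0 and [b] at 1. *)
Definition differs c z := c z != c x.

Definition separated S c := S c /\ c x != c b.

Definition anchored S := forall c, S c -> c x = c b -> non_minority c x.

Definition ball_le S u v := forall c, separated S c -> differs c u -> differs c v.

Definition ball_ne S u v := forall c, separated S c -> differs c u = ~~ differs c v.

Definition determined_by S u z :=
  exists g : bool -> bool, forall c, separated S c -> differs c z = g (differs c u).

Definition known S z := exists g : bool, forall c, separated S c -> differs c z = g.

Lemma anchored_refines S S' : refines S' S -> anchored S -> anchored S'.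
Proof. by move=> sub anc c /sub; apply: anc. Qed.

Lemma separated_refines S S' : refines S' S -> refines (separated S') (separated S).
Proof. by move=> sub c [/sub Sc ne]. Qed.

(* Whichever of x, b, w the last query returns is correct: it agrees with one of the
   other two, so it has the colour of x if x and b agree, and otherwise either it is w
   or it agrees with w. *)
Lemma winnable_last_query S w :
  anchored S -> (forall c, separated S c -> non_minority c w) -> winnable S 1.
Proof.
move=> anc good.
have good_x c : S c -> c x = c w \/ c x = c b -> non_minority c x.
  move=> Sc; have [eq_xb _|ne] := eqVneq (c x) (c b); first exact: anc.
  by case=> [eq_xw|/eqP]; [rewrite (non_minority_eq eq_xw) good | rewrite (negbTE ne)].
have good_b c : S c -> c b = c w \/ c b = c x -> non_minority c b.
  move=> Sc; have [eq_xb _|ne] := eqVneq (c x) (c b).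
    by rewrite -(non_minority_eq eq_xb) anc.
  by case=> [eq_bw|/eqP]; [rewrite (non_minority_eq eq_bw) good | rewrite eq_sym (negbTE ne)].
have good_w c : S c -> c w = c x \/ c w = c b -> non_minority c w.
  move=> Sc; have [eq_xb|ne _] := eqVneq (c x) (c b); last exact: good.
  by rewrite -eq_xb => -[] eq_wx; rewrite (non_minority_eq eq_wx) anc.
have [xw|xw] := eqVneq x w.
  by apply: (winnable_name (b := w)) => c Sc; apply: good_w; rewrite // xw; left.
have [bw|bw] := eqVneq b w.
  by apply: (winnable_name (b := w)) => c Sc; apply: good_w; rewrite // bw; right.
apply: (winnable_ask3 neq_xb xw bw).
- apply: (winnable_name (b := x)) => c [Sc] []; auto.
- apply: (winnable_name (b := b)) => c [Sc] []; auto.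
- by apply: (winnable_name (b := w)) => c [Sc]; apply: good_w.
Qed.

(** Answers [u] and [v] to {x, u, v} order the pair at once. Answer [x] excludes that both differ
    from [x]; then {b, u, v} either orders the pair or excludes that both differ from [b], which
    makes them opposite. *)
Lemma compare_or_differ u v S k :
  (forall S', refines S' S -> ball_le S' u v -> winnable S' k) ->
  (forall S', refines S' S -> ball_le S' v u -> winnable S' k) ->
  (forall S', refines S' S -> ball_ne S' u v -> winnable S' k) ->
  winnable S (k + 2).
Proof.
move=> le_uv le_vu ne_uv; rewrite addn2.
have sub1 Q : refines (fun c => S c /\ Q c) S by move=> c [].
(* Pairs that do not form triples with both [x] and [b] need no query: [x] is least and [b]
   greatest. *)
have le_x z S' : ball_le S' x z by move=> c _; rewrite /differs eqxx.
have le_b z S' : ball_le S' z b by move=> c [_]; rewrite /differs eq_sym.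
have easy : ball_le S u v \/ ball_le S v u -> winnable S k.+2.
  by move=> le; apply: (@winnable_leq _ k); [lia | case: le => le; [apply: le_uv|apply: le_vu]].
have [xu|xu] := eqVneq x u; first by apply: easy; left; rewrite -xu.
have [xv|xv] := eqVneq x v; first by apply: easy; right; rewrite -xv.
have [bu|bu] := eqVneq b u; first by apply: easy; right; rewrite -bu.
have [bv|bv] := eqVneq b v; first by apply: easy; left; rewrite -bv.
have [uv|uv] := eqVneq u v; first by apply: easy; left; rewrite uv.
apply: (winnable_ask3 xu xv uv).
- apply: (winnable_ask3 bu bv uv).
  + apply: ne_uv => [c [[]] //|c [[[_ +] +] +]]; rewrite /differs.
    by case: (c x) (c b) (c u) (c v) => [] [] [] [] //= [] // _ [].
  + apply: le_vu => [c [[]] //|c [[[_ _] +] +]]; rewrite /differs.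
    by case: (c x) (c b) (c u) (c v) => [] [] [] [] //= [].
  + apply: le_uv => [c [[]] //|c [[[_ _] +] +]]; rewrite /differs.
    by case: (c x) (c b) (c u) (c v) => [] [] [] [] //= [].
- apply: (@winnable_leq _ k); first lia.
  apply: le_uv => [|c [[_ +] _]] //; rewrite /differs.
  by case: (c x) (c u) (c v) => [] [] [] //= [].
- apply: (@winnable_leq _ k); first lia.
  apply: le_vu => [|c [[_ +] _]] //; rewrite /differs.
  by case: (c x) (c u) (c v) => [] [] [] //= [].
Qed.

Lemma non_minority_differs c w :
  non_minority c w = (n <= 2 * #|[set z | differs c z == differs c w]|).
Proof.
rewrite /non_minority; congr (_ <= 2 * _); apply: eq_card => z; rewrite !inE /differs.
by case: (c z) (c w) (c x) => [] [] [].
Qed.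

(* Only one unknown bit, differs c u, is left, and for each of its values one of
   x, b is correct; so one of x, b, u, v is correct for both. *)
Lemma winnable_determined S u v :
  anchored S -> ball_ne S u v -> (forall z, determined_by S u z) -> winnable S 1.
Proof.
move=> anc ne det.
have same c c' : separated S c -> separated S c' -> differs c u = differs c' u ->
    forall z, differs c z = differs c' z.
  by move=> Sc Sc' eq_u z; have [g gz] := det z; rewrite !gz // eq_u.
have choice (a : bool) :
    (forall c, separated S c -> differs c u = a -> non_minority c x) \/
    (forall c, separated S c -> differs c u = a -> non_minority c b).
  have [[c [Sc cu good_x]]|none] :=
    classic (exists c, [/\ separated S c, differs c u = a & non_minority c x]).
    left=> c' Sc' c'u; have eq_c := same _ _ Sc' Sc (etrans c'u (esym cu)).
    rewrite non_minority_differs -[X in _ <= 2 * X](_ : #|[set z | differs c z == differs c x]| = _).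
      by rewrite -non_minority_differs.
    by apply: eq_card => z; rewrite !inE !eq_c.
  right=> c Sc cu; have [_ ne_xb] := Sc; have /orP[good_x|//] := non_minority_or ne_xb.
  by case: none; exists c.
have like_x c z : differs c z = false -> non_minority c z = non_minority c x.
  by move=> /negbFE/eqP; apply: non_minority_eq.
have like_b c z : separated S c -> differs c z = true -> non_minority c z = non_minority c b.
  move=> [_ +] dz; move: dz; rewrite /differs => dz xb; apply: non_minority_eq.
  by case: (c z) (c x) (c b) dz xb => [] [] [].
(* The ball [u] has the color of [x] when the bit is false and of [b] when it is true, and [v] the
   reverse; so [u] and [v] serve the two mixed cases. *)
case: (choice false) (choice true) => [f|f] [t|t].
- by apply: (winnable_last_query (w := x)) => // c Sc; case E: (differs c u); auto.
- apply: (winnable_last_query (w := u)) => // c Sc; case E: (differs c u).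
    by rewrite like_b // t.
  by rewrite like_x // f.
- apply: (winnable_last_query (w := v)) => // c Sc; case E: (differs c u).
    by rewrite like_x ?t //; move: (ne c Sc); rewrite E; case: (differs c v).
  by rewrite like_b ?f //; move: (ne c Sc); rewrite E; case: (differs c v).
- by apply: (winnable_last_query (w := b)) => // c Sc; case E: (differs c u); auto.
Qed.

(** The potential of the amortization: each ball of [U] carries a credit of 4, the cost of comparing
    it with both balls of an opposite pair. *)
Definition all_known_but S (U : seq 'I_n) := forall z, z \notin U -> known S z.

Lemma known_refines S S' z : refines S' S -> known S z -> known S' z.
Proof. by move=> sub [g gz]; exists g => c /(separated_refines sub)/gz. Qed.

Lemma determined_by_refines S S' u z :
  refines S' S -> determined_by S u z -> determined_by S' u z.
Proof. by move=> sub [g gz]; exists g => c /(separated_refines sub)/gz. Qed.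

Lemma ball_le_refines S S' u v : refines S' S -> ball_le S u v -> ball_le S' u v.
Proof. by move=> sub le c /(separated_refines sub)/le. Qed.

Lemma ball_ne_refines S S' u v : refines S' S -> ball_ne S u v -> ball_ne S' u v.
Proof. by move=> sub ne c /(separated_refines sub)/ne. Qed.

(* A ball w compared with two opposite balls u, v is equal to one of them, or known,
   or lies between them; in the last case u, v and everything scanned so far become
   known, which pays for the scan. *)
Lemma scan_opposites u v (rest : seq 'I_n) S k :
  anchored S -> ball_ne S u v ->
  (forall z, z \notin rest -> determined_by S u z) ->
  (forall S' U', refines S' S -> size U' <= size rest -> all_known_but S' U' ->
     ball_le S' u v \/ ball_le S' v u -> winnable S' (k + 4 * size U')) ->
  winnable S (k + 4 * size rest + 4).
Proof.
elim: rest S => [|w rest IH] S anc ne det cont.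
  apply: (@winnable_leq _ 1); first lia.
  by apply: winnable_determined ne _ => // z; apply: det.
have next S' : refines S' S -> determined_by S' u w -> winnable S' (k + 4 * size rest + 4).
  move=> sub det_w; apply: IH; first exact: anchored_refines anc.
  - exact: ball_ne_refines ne.
  - move=> z zrest; have [-> //|zw] := eqVneq z w.
    by apply: determined_by_refines (det z _) => //; rewrite inE negb_or zw.
  - move=> S2 U' sub2 sz kn le; apply: (cont S2 U' _ (leqW sz)) => //.
    by move=> c /sub2 /sub.
have collapse S' : refines S' S -> ball_le S' u v \/ ball_le S' v u ->
    winnable S' (k + 4 * (size rest).+1).
  move=> sub le; apply: (cont S' (w :: rest)) => // z /det [g gz].
  have ne' := ball_ne_refines sub ne.
  case: le => le; [exists (g false) | exists (g true)] => c Sc;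
    rewrite gz; try exact: (separated_refines sub); congr g;
    move: (ne' c Sc) (le c Sc); case: (differs c u) (differs c v) => [] [] //= _ /(_ isT) //.
rewrite (_ : _ + 4 = k + 4 * size rest + 4 + 2 + 2); last by rewrite /=; lia.
(* If [u] and [v] get ordered here, [w] may still be unknown; the spare 4 restores its credit. *)
have budget : k + 4 * size rest + 4 = k + 4 * (size rest).+1 by lia.
apply: (compare_or_differ (u := w) (v := u)) => S1 sub1 rel1.
- apply: (compare_or_differ (u := w) (v := v)) => S2 sub2 rel2;
  have sub : refines S2 S by [move=> c /sub2 /sub1]; have ne2 := ball_ne_refines sub ne;
  have le1 := ball_le_refines sub2 rel1.
  + apply: next => //; exists (fun=> false) => c Sc.
    apply/negbTE/negP => dw; have := le1 c Sc dw.
    by rewrite (ne2 c Sc) (rel2 c Sc dw).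
  + rewrite budget; apply: collapse => //; right=> c Sc /(rel2 c Sc).
    exact: le1 c Sc.
  + apply: next => //; exists id => c Sc; rewrite (rel2 c Sc) (ne2 c Sc) //.
- apply: (compare_or_differ (u := w) (v := v)) => S2 sub2 rel2;
  have sub : refines S2 S by [move=> c /sub2 /sub1]; have ne2 := ball_ne_refines sub ne;
  have le1 := ball_le_refines sub2 rel1.
  + rewrite budget; apply: collapse => //; left=> c Sc du; apply: (rel2 c Sc).
    exact: le1 c Sc du.
  + apply: next => //; exists (fun=> true) => c Sc.
    case dv: (differs c v); first exact: rel2.
    by apply: (le1 c Sc); rewrite (ne2 c Sc) dv.
  + apply: next => //; exists id => c Sc; rewrite (rel2 c Sc) (ne2 c Sc) //.
- apply: (@winnable_leq _ (k + 4 * size rest + 4)); first lia.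
  by apply: next => //; exists negb.
Qed.

(** Amortized cost 6: 2 for the direct comparison and the spare 4 of the scan, whose remaining cost
    is paid by the credit of the balls that leave [U]. *)
Lemma compare u v (U : seq 'I_n) S k :
  anchored S -> all_known_but S U ->
  (forall S' U', refines S' S -> size U' <= size U -> all_known_but S' U' ->
     ball_le S' u v \/ ball_le S' v u -> winnable S' (k + 4 * size U')) ->
  winnable S (k + 4 * size U + 6).
Proof.
move=> anc kn cont; rewrite (_ : _ + 6 = k + 4 * size U + 4 + 2); last lia.
have kn' S' : refines S' S -> all_known_but S' U.
  by move=> sub z /kn; apply: known_refines.
apply: (compare_or_differ (u := u) (v := v)) => S' sub rel.
- by apply: (@winnable_leq _ (k + 4 * size U)); [lia | apply: cont (kn' _ sub) _; auto].
- by apply: (@winnable_leq _ (k + 4 * size U)); [lia | apply: cont (kn' _ sub) _; auto].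
apply: scan_opposites rel _ _; first exact: anchored_refines anc.
  by move=> z /kn /(known_refines sub)[g gz]; exists (fun=> g).
by move=> S2 U' sub2; apply: cont => c /sub2 /sub.
Qed.

Definition majority_found (P : ('I_n -> bool) -> Prop) :=
  exists w, forall f, P f -> n <= 2 * #|[set z | f z == f w]|.

(** The comparison tree is simulated at amortized cost 6 per comparison, with the initial credit of
    [U] and one final query added. *)
Lemma winnable_of_cmp_solvable P d U S :
  cmp_solvable majority_found P d ->
  anchored S -> all_known_but S U -> (forall c, separated S c -> P (differs c)) ->
  winnable S (1 + 6 * d + 4 * size U).
Proof.
move=> sol; elim: sol S U => {P d} [P d [w good]|u v P d _ IH1 _ IH2] S U anc kn SP.
  apply: (@winnable_leq _ 1); first lia.
  by apply: (winnable_last_query (w := w)) => // c /SP /good; rewrite non_minority_differs.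
rewrite (_ : _ + _ = 1 + 6 * d + 4 * size U + 6); last lia.
apply: (compare (u := u) (v := v)) => // S' U' sub _ kn' [le|le].
  apply: IH1 => // [|c Sc]; first exact: anchored_refines anc.
  by split; [apply: SP; apply: separated_refines Sc | apply: le].
apply: IH2 => // [|c Sc]; first exact: anchored_refines anc.
by split; [apply: SP; apply: separated_refines Sc | apply: le].
Qed.

End References.

(** * Median as non-minority ball, and the linear strategy *)

Lemma median_search : 0 < n ->
  cmp_solvable majority_found (fun=> True) (68 * n).
Proof.
move=> n_gt0; have sz : size (enum 'I_n) = n by rewrite size_enum_ord.
have lt_half : n.-1./2 < size (enum 'I_n) by rewrite sz; lia.
have := @selectable_linear _ majority_found _ id _ _ lt_half (fun=> True) 0.
rewrite sz add0n; apply=> P A w B _ szA [prm leA leB].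
have szB : size A + (size B).+1 = n.
  by have := perm_size prm; rewrite size_cat /= sz.
have [largeA largeB] : n <= 2 * (size A).+1 /\ n <= 2 * (size B).+1 by lia.
have uAwB : uniq (A ++ w :: B) by rewrite -(perm_uniq prm) enum_uniq.
have large (f : 'I_n -> bool) (s : seq 'I_n) : uniq s -> n <= 2 * size s ->
    {in s, forall z, f z = f w} -> n <= 2 * #|[set z | f z == f w]|.
  move=> us le_ns same; apply: leq_trans le_ns _; rewrite leq_pmul2l //.
  rewrite -(card_uniqP us); apply: subset_leq_card.
  by apply/subsetP => z zs; rewrite inE same.
(* If the median [w] has value 1, so does everything in [B]; if 0, so does everything in [A]. Either
   side together with [w] holds at least half of the balls. *)
apply: CmpDone; exists w => f Pf; case fw: (f w).
  rewrite -fw; apply: (large f (w :: B)).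
  - by move: uAwB; rewrite cat_uniq => /and3P[].
  - exact: largeB.
  - by move=> z; rewrite inE fw => /orP[/eqP -> //|/leB]; apply.
rewrite -fw; apply: (large f (rcons A w)).
- by move: uAwB; rewrite -cat_rcons cat_uniq => /andP[].
- by rewrite size_rcons.
- move=> z; rewrite mem_rcons inE fw => /orP[/eqP -> //|/leA le_zw].
  by apply/negbTE/negP => /(le_zw f Pf); rewrite fw.
Qed.

Lemma winnable_linear : 0 < n -> winnable (fun=> True) (420 * n).
Proof.
move=> n_gt0; pose x : 'I_n := Ordinal n_gt0.
case El: (rem x (enum 'I_n) : seq 'I_n) => [|b l].
  have sz : n.-1 = 0.
    by rewrite -[RHS](congr1 size El) size_rem ?mem_enum // size_enum_ord.
  apply: (winnable_name (b := x)) => c _; rewrite /non_minority.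
  have : 0 < #|[set z | c z == c x]| by apply/card_gt0P; exists x; rewrite inE.
  by lia.
have prm : perm_eq (enum 'I_n) (x :: b :: l) by rewrite -El perm_to_rem ?mem_enum.
have szl : (size l).+2 = n.
  by have := perm_size prm; rewrite size_enum_ord.
have uxbl : uniq (x :: l ++ [:: b]).
  rewrite (perm_uniq (s2 := enum 'I_n)) ?enum_uniq // perm_sym (perm_trans prm) //.
  by rewrite perm_cons cats1 perm_sym perm_rcons.
(* Final query, 68n amortized comparisons, initial credit and vote: less than 413n in total. *)
apply: (@winnable_leq _ (1 + 6 * (68 * n) + 4 * n + size l)); first by lia.
apply: (find_challenger (x := x) (b := b) (p := [:: b]) (k := 1)) => //.
- exact: mem_head.
- by move=> c _ /=; case: eqP.
move=> S b' _ b'x le_cnt.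
have anc : anchored x b' S.
  move=> c Sc /esym /(le_cnt c Sc); rewrite /non_minority.
  have -> : #|[set z | c z == c x]| = count (fun z => c z == c x) (enum 'I_n).
    by rewrite cardsE cardE -size_filter enumT.
  have /permP cnt := prm; rewrite cnt /= eqxx !count_cat /=.
  have tot : count (fun z => c z == c x) l + count (fun z => c z != c x) l = size l.
    exact: count_predC.
  move: szl; rewrite -tot; move: (count _ l) (count _ l) => m0 m1.
  by case: (c b == c x) => /=; clear; lia.
rewrite -{2}(size_enum_ord n).
apply: (winnable_of_cmp_solvable _ (median_search n_gt0) anc) => //.
- by rewrite eq_sym.
- by move=> z; rewrite mem_enum.
Qed.

End Game.

(** * From a bounded strategy to the value of $A_3$ *)

Lemma play_exists n (s : strategy n) : exists h b, play s h b.
Proof.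
(* In a monochromatic coloring every ball of a triple is a majority ball of it. *)
suff [h [b [run_h cons]]] : exists h b, run s h b /\ consistent [ffun=> true] h.
  by exists h, b; split=> //; exists [ffun=> true].
elim: s => [b|Q next IH]; first by exists [::], b; split=> //; apply: RunName.
have /eqP cQ := valP Q.
have [a aQ] : exists a, a \in val Q by apply/card_gt0P; rewrite cQ.
have [h [b [run_h cons]]] := IH a.
exists ((Q, a) :: h), b; split; first exact: RunAsk.
rewrite /= cons andbT /majority_ball aQ /=.
have [d] : exists d, d \in val Q :\ a.
  by apply/card_gt0P; have := cardsD1 a (val Q); rewrite aQ cQ; lia.
by rewrite !inE => /andP[da dQ]; apply/exists_inP; exists d => //; rewrite da !ffunE.
Qed.

Lemma least_nat (P : nat -> Prop) m :
  P m -> exists k, [/\ P k, k <= m & forall k', P k' -> k <= k'].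
Proof.
have [N] := ubnP m; elim: N m => // N IH m lt_mN Pm.
have [[k [Pk lt_km]]|none] := classic (exists k, P k /\ k < m).
  have [k0 [Pk0 le_k0 min]] := IH k (leq_trans lt_km lt_mN) Pk.
  by exists k0; split=> //; apply: leq_trans le_k0 (ltnW lt_km).
exists m; split=> // k Pk; rewrite leqNgt; apply/negP => lt_km.
by apply: none; exists k.
Qed.

(** The least bound on the lengths of plays is attained: otherwise its predecessor would be a bound
    too, and it is positive because a play exists. *)
Lemma worst_case_exists n (s : strategy n) N :
  (forall h b, play s h b -> size h <= N) -> exists2 k, worst_case s k & k <= N.
Proof.
move=> /(@least_nat (fun N => forall h b, play s h b -> size h <= N)).
case=> k [bound le_kN min]; exists k => //; split=> //; apply: NNPP => none.
have lt h b : play s h b -> size h < k.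
  move=> pl; rewrite ltn_neqAle (bound _ _ pl) andbT; apply/eqP => eq_k.
  by apply: none; exists h, b.
have [h [b /lt lt_hk]] := play_exists s.
have : k <= k.-1 by apply: min => h' b' /lt; lia.
by lia.
Qed.

Theorem theorem2 :
  exists C : nat, forall n : nat, 0 < n ->
  exists k : nat, is_A3 n k /\ k <= C * n.
Proof.
exists 420 => n n_gt0; have [s win] := winnable_linear n_gt0.
have succ : successful s.
  by move=> h b [run_h _] c; apply: (proj2 (win h b run_h)).
have [k0 wc0 le_k0] : exists2 k, worst_case s k & k <= 420 * n.
  by apply: worst_case_exists => h b [/win[]].
have [k [ex le_k min]] := @least_nat
  (fun k => exists s : strategy n, successful s /\ worst_case s k) k0
  (ex_intro _ s (conj succ wc0)).
exists k; split; last exact: leq_trans le_k0.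
by split=> // s' k' succ' wc'; apply: min; exists s'.
Qed.
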